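(* Let $A\in\mathbf{R}^{n\times n}$ be symmetric positive definite with largest eigenvalue $\lambda_1$, let $b\in\mathbf{R}^n$, and let $f(x)=\tfrac12x^TAx-b^Tx$. Let $x^{(-1)}\in\mathbf{R}^n$ be arbitrary and set $$x^{(0)}=x^{(-1)}-\tfrac1{\lambda_1}\bigl(Ax^{(-1)}-b\bigr).$$ Then Gradient Descent with the fixed step size $\alpha=2/\lambda_1$ started from $x^{(0)}$, i.e. the iteration $x^{(k+1)}=x^{(k)}-\tfrac{2}{\lambda_1}\bigl(Ax^{(k)}-b\bigr)$ for $k\ge0$, converges to the minimizer $x^*=A^{-1}b$ of $f$ over $\mathbf{R}^n$, that is, $x^{(k)}\to x^*$ as $k\to\infty$.
   Context: Gradient Descent is used without momentum, and the gradient of $f$ is $Ax-b$. *)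

(* Defs.v *)
From mathcomp Require Import all_boot all_order all_algebra.
From mathcomp Require Import all_classical all_reals all_analysis.

Set Implicit Arguments.
Unset Strict Implicit.
Unset Printing Implicit Defensive.

Import Order.TTheory GRing.Theory Num.Theory.
Import numFieldNormedType.Exports.

Local Open Scope classical_set_scope.
Local Open Scope ring_scope.

Definition symmetric_posdef (R : realType) (n : nat) (A : 'M[R]_n) : Prop :=
  A^T = A /\ forall x : 'cV[R]_n, x != 0 -> 0 < (x^T *m A *m x) 0 0.

(* [eigenvalue] is about row eigenvectors; A and A^T have the same eigenvalues.
   The first conjunct excludes n = 0. *)
Definition largest_eigenvalue (R : realType) (n : nat) (A : 'M[R]_n) (l : R)
    : Prop :=
  eigenvalue A l /\ forall m : R, eigenvalue A m -> m <= l.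

(* The codomain is R^o because derivatives take values in a normed module. *)
Definition quadratic (R : realType) (n : nat) (A : 'M[R]_n) (b : 'cV[R]_n)
    (x : 'cV[R]_n) : R^o :=
  2^-1 * (x^T *m A *m x) 0 0 - (b^T *m x) 0 0.

Definition gradient (R : realType) (n : nat) (f : 'cV[R]_n -> R^o)
    (x : 'cV[R]_n) : 'cV[R]_n :=
  \col_(i < n) 'D_(delta_mx i 0) f x.

Definition gradient_descent (R : realType) (n : nat) (f : 'cV[R]_n -> R^o)
    (alpha : R) (x0 : 'cV[R]_n) (k : nat) : 'cV[R]_n :=
  iter k (fun y => y - alpha *: gradient f y) x0.

Definition minimizer (R : realType) (n : nat) (f : 'cV[R]_n -> R^o)
    (x : 'cV[R]_n) : Prop :=
  forall y : 'cV[R]_n, f x <= f y.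

Definition unique_minimizer (R : realType) (n : nat) (f : 'cV[R]_n -> R^o)
    (x : 'cV[R]_n) : Prop :=
  minimizer f x /\ forall z : 'cV[R]_n, minimizer f z -> z = x.

(* Main.v *)
Require Import Defs.
From mathcomp Require Import all_boot all_order all_algebra.
From mathcomp Require Import all_classical all_reals all_analysis.
From mathcomp Require Import ring lra.

Set Implicit Arguments.
Unset Strict Implicit.
Unset Printing Implicit Defensive.

Import Order.TTheory GRing.Theory Num.Theory.
Import numFieldNormedType.Exports.

Local Open Scope classical_set_scope.
Local Open Scope ring_scope.

(** Write l for the largest eigenvalue and e_k = x_k - xstar.  Since the gradient
is A (x - xstar), one step multiplies the error by B = 1 - (2 / l) A, whose
eigenvalues lie in [-1, 1).  The value -1 is attained exactly on the eigenspace
of l, so plain gradient descent with step 2 / l would oscillate there; the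
initial half-length step multiplies the error by 1 - A / l = (1 + B) / 2, which
kills that eigenspace.

No diagonalization is needed to turn this into a convergence proof.  Put
u_0 = A^-1 (xm1 - xstar) and u_(k+1) = B u_k, so that e_k = A u_k - A A u_k / l.
The quantity E(u) = <u, A u> - <A u, A u> / l satisfies
  E(u_k) - E(u_(k+1)) = (4 / l) <e_k, e_k>      ([energy_step]),
  E(u) >= 0                                     ([energy_ge0]).
Hence E(u_k) is nonincreasing and bounded below, it converges, and its
differences, which are multiples of |e_k|^2, tend to 0
([filtered_gd_cvg0]).

The largest eigenvalue enters through <u, A u> <= l <u, u>
([form_le_largest_eigenvalue]), which gives E >= 0 by the Cauchy-Schwarz
inequality for the form of A.  It is proved from the completeness of the reals
alone: if mu is the least real with <u, A u> <= mu <u, u> for all u, then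
mu - A is positive semidefinite; were it invertible, it would be coercive
([psd_unitmx_coercive]) and mu could be lowered.  So mu is an eigenvalue, and
mu <= l. *)

(** * Inner product and positive semidefinite forms *)

Definition dot (R : realType) (n : nat) (u v : 'cV[R]_n) : R := (u^T *m v) 0 0.

Definition possemidef (R : realType) (n : nat) (S : 'M[R]_n) : Prop :=
  forall u : 'cV[R]_n, 0 <= dot u (S *m u).

Lemma dotE (R : realType) (n : nat) (u v : 'cV[R]_n) :
  dot u v = \sum_i u i 0 * v i 0.
Proof. by rewrite /dot mxE; apply: eq_bigr => i _; rewrite mxE. Qed.

Lemma dotC (R : realType) (n : nat) (u v : 'cV[R]_n) : dot u v = dot v u.
Proof. by rewrite !dotE; apply: eq_bigr => i _; rewrite mulrC. Qed.

Lemma dotDr (R : realType) (n : nat) (u v w : 'cV[R]_n) :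
  dot u (v + w) = dot u v + dot u w.
Proof. by rewrite /dot mulmxDr mxE. Qed.

Lemma dotZr (R : realType) (n : nat) (a : R) (u v : 'cV[R]_n) :
  dot u (a *: v) = a * dot u v.
Proof. by rewrite /dot -scalemxAr mxE. Qed.

Lemma dotNr (R : realType) (n : nat) (u v : 'cV[R]_n) :
  dot u (- v) = - dot u v.
Proof. by rewrite /dot mulmxN mxE. Qed.

Lemma dotDl (R : realType) (n : nat) (u v w : 'cV[R]_n) :
  dot (u + v) w = dot u w + dot v w.
Proof. by rewrite ![dot _ w]dotC dotDr. Qed.

Lemma dotZl (R : realType) (n : nat) (a : R) (u v : 'cV[R]_n) :
  dot (a *: u) v = a * dot u v.
Proof. by rewrite ![dot _ v]dotC dotZr. Qed.

Lemma dotNl (R : realType) (n : nat) (u v : 'cV[R]_n) :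
  dot (- u) v = - dot u v.
Proof. by rewrite ![dot _ v]dotC dotNr. Qed.

Definition dot_bilin := (dotDl, dotDr, dotNl, dotNr, dotZl, dotZr).

Lemma dot_sym (R : realType) (n : nat) (S : 'M[R]_n) (u v : 'cV[R]_n) :
  S^T = S -> dot u (S *m v) = dot v (S *m u).
Proof. by move=> symS; rewrite dotC /dot trmx_mul symS mulmxA. Qed.

Lemma sqr_coord_le (R : realType) (n : nat) (u : 'cV[R]_n) (i : 'I_n) :
  u i 0 ^+ 2 <= dot u u.
Proof.
rewrite dotE (bigD1 i) //= -expr2 lerDl.
by apply: sumr_ge0 => j _; rewrite -expr2 sqr_ge0.
Qed.

Lemma dot_ge0 (R : realType) (n : nat) (u : 'cV[R]_n) : 0 <= dot u u.
Proof. by rewrite dotE; apply: sumr_ge0 => i _; rewrite -expr2 sqr_ge0. Qed.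

Lemma dot_gt0 (R : realType) (n : nat) (u : 'cV[R]_n) : u != 0 -> 0 < dot u u.
Proof.
move=> u_neq0; rewrite lt_neqAle dot_ge0 andbT eq_sym.
apply: contra_neq u_neq0 => uu0; apply/colP => i; rewrite mxE.
by apply/eqP; rewrite -sqrf_eq0 eq_le sqr_ge0 -uu0 sqr_coord_le.
Qed.

(** The sum of the absolute values of the entries bounds the form, because each
product of two coordinates is at most [dot u u] in absolute value. *)
Lemma quadratic_form_bounded (R : realType) (n : nat) (M : 'M[R]_n) :
  exists2 C : R, 0 < C & forall u : 'cV[R]_n, dot u (M *m u) <= C * dot u u.
Proof.
exists (1 + \sum_i \sum_j `|M i j|).
  by rewrite ltr_pwDl // sumr_ge0 // => i _; rewrite sumr_ge0.
move=> u; rewrite mulrDl mul1r -[leLHS]add0r lerD ?dot_ge0 //.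
rewrite dotE mulr_suml; apply: ler_sum => i _.
rewrite mxE mulr_sumr mulr_suml; apply: ler_sum => j _.
have ui := sqr_coord_le u i; have uj := sqr_coord_le u j.
apply: le_trans (ler_norm _) _; rewrite mulrCA normrM ler_wpM2l //.
rewrite ler_norml; apply/andP; split; nra.
Qed.

(** The usual discriminant argument, for a form that may be degenerate: the form
at s u - t v is nonnegative for all s and t. *)
Lemma psd_cauchy_schwarz (R : realType) (n : nat) (S : 'M[R]_n) :
  S^T = S -> possemidef S -> forall u v : 'cV[R]_n,
  dot u (S *m v) ^+ 2 <= dot u (S *m u) * dot v (S *m v).
Proof.
move=> symS psdS u v.
have disc s t : 0 <= s ^+ 2 * dot u (S *m u) - 2 * s * t * dot u (S *m v)
                     + t ^+ 2 * dot v (S *m v).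
  have := psdS (s *: u - t *: v).
  rewrite mulmxBr -!scalemxAr !dot_bilin [dot v (S *m u)]dot_sym //.
  by congr (0 <= _); ring.
move: (psdS u) (psdS v) disc.
set a := dot u _; set b := dot u _; set c := dot v _ => a0 c0 disc.
have [c_gt0 | /(conj c0)/andP/le_anti c_eq0] := ltrP 0 c.
  (* Up to scaling, the minimizer of the form on the line u - t v. *)
  have := disc c b.
  rewrite (_ : _ + _ = c * (a * c - b ^+ 2)); last by ring.
  by rewrite pmulr_rge0 // subr_ge0.
rewrite -c_eq0 mulr0.
(* The form vanishes at v, so the discriminant bound is linear in t; this choice
   makes it the inequality 0 <= - (a + 2) b^2. *)
have := disc b (a + 1); rewrite -c_eq0 => d.
have := sqr_ge0 b; nra.
Qed.

(** * Eigenvalues of symmetric matrices *)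

Lemma eigenvalue_unitmx (R : realType) (n : nat) (A : 'M[R]_n) (a : R) :
  eigenvalue A a = (a%:M - A \notin unitmx).
Proof.
by rewrite /eigenvalue /eigenspace kermx_eq0 row_free_unit -opprB -scaleN1r
  unitmxZ ?unitrN1.
Qed.

Lemma eigenvalue_posdef_gt0 (R : realType) (n : nat) (A : 'M[R]_n) (a : R) :
  symmetric_posdef A -> eigenvalue A a -> 0 < a.
Proof.
move=> [symA posA] /eigenvalueP[v vA v_neq0].
have vT_neq0 : v^T != 0 by rewrite trmx_eq0.
have := posA _ vT_neq0.
rewrite trmxK vA -scalemxAl mxE pmulr_lgt0 //.
by have := dot_gt0 vT_neq0; rewrite /dot trmxK.
Qed.

Lemma posdef_unitmx (R : realType) (n : nat) (A : 'M[R]_n) :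
  symmetric_posdef A -> A \in unitmx.
Proof.
move=> spdA; apply: contraTT isT => A_sing.
have /(eigenvalue_posdef_gt0 spdA) : eigenvalue A 0.
  by rewrite eigenvalue_unitmx raddf0 sub0r -scaleN1r unitmxZ ?unitrN1.
by rewrite ltxx.
Qed.

Lemma posdef_possemidef (R : realType) (n : nat) (A : 'M[R]_n) :
  symmetric_posdef A -> possemidef A.
Proof.
move=> [_ posA] u; have [-> | u_neq0] := eqVneq u 0.
  by rewrite mulmx0 /dot mulmx0 mxE.
by rewrite ltW // /dot mulmxA posA.
Qed.

(** Cauchy-Schwarz for the form of S, applied to u and S^-1 u, gives
|u|^4 <= <u, S u> <u, S^-1 u> <= C |u|^2 <u, S u>. *)
Lemma psd_unitmx_coercive (R : realType) (n : nat) (S : 'M[R]_n) :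
  S^T = S -> possemidef S -> S \in unitmx ->
  exists2 e : R, 0 < e & forall u : 'cV[R]_n, e * dot u u <= dot u (S *m u).
Proof.
move=> symS psdS unitS.
have [C C_gt0 boundC] := quadratic_form_bounded (invmx S).
exists C^-1; first by rewrite invr_gt0.
move=> u; rewrite ler_pdivrMl //.
have := psd_cauchy_schwarz symS psdS u (invmx S *m u).
rewrite mulKVmx // [dot (_ *m _) u]dotC => cs.
have := boundC u; have := psdS u; have := dot_ge0 u => uu0 uSu0 uC.
have [->|uu_neq0] := eqVneq (dot u u) 0; first by rewrite mulr_ge0 // ltW.
rewrite -(@ler_pM2r _ (dot u u)) ?lt_neqAle ?uu0 ?andbT 1?eq_sym //.
nra.
Qed.

(** The infimum of all upper bounds of the Rayleigh quotient is an eigenvalue: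
otherwise [inf T - A] would be invertible, hence coercive, and a smaller upper
bound would exist. *)
Lemma form_le_largest_eigenvalue (R : realType) (n : nat) (A : 'M[R]_n)
    (l : R) : A^T = A -> largest_eigenvalue A l ->
  forall u : 'cV[R]_n, dot u (A *m u) <= l * dot u u.
Proof.
move=> symA [/eigenvalueP[w _ w_neq0] maxl].
(* A nonzero vector is what bounds T below. *)
have {w_neq0} v_neq0 : w^T != 0 by rewrite trmx_eq0.
move: (w^T) v_neq0 => v v_neq0 {w}.
pose T := [set t : R | forall u : 'cV[R]_n, dot u (A *m u) <= t * dot u u].
have ratio_lb (u : 'cV[R]_n) : u != 0 -> lbound T (dot u (A *m u) / dot u u).
  by move=> u_neq0 t Tt; rewrite ler_pdivrMr ?dot_gt0.
have infT_lb : lbound T (inf T).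
  by apply: ge_inf; exists (dot v (A *m v) / dot v v); exact: ratio_lb.
have T_infT : T (inf T).
  move=> u; have [->|u_neq0] := eqVneq u 0.
    by rewrite mulmx0 /dot mulmx0 mxE mulr0.
  rewrite -ler_pdivrMr ?dot_gt0 //; apply: lb_le_inf; last exact: ratio_lb.
  by have [C _ TC] := quadratic_form_bounded A; exists C.
suff eig : eigenvalue A (inf T).
  by move=> u; rewrite (le_trans (T_infT u)) // ler_wpM2r ?dot_ge0 // maxl.
rewrite eigenvalue_unitmx; apply/negP => unitS.
have symS : ((inf T)%:M - A)^T = (inf T)%:M - A.
  by rewrite linearB /= tr_scalar_mx symA.
have formS (u : 'cV[R]_n) :
    dot u (((inf T)%:M - A) *m u) = inf T * dot u u - dot u (A *m u).
  by rewrite mulmxBl mul_scalar_mx !dot_bilin.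
have psdS : possemidef ((inf T)%:M - A).
  by move=> u; rewrite formS subr_ge0.
have [e e_gt0 coerc] := psd_unitmx_coercive symS psdS unitS.
have /infT_lb : T (inf T - e).
  by move=> u; rewrite mulrBl lerBrDl -lerBrDr -formS.
by rewrite lerBrDl gerDr leNgt e_gt0.
Qed.

(** * The quadratic objective *)

(** The Taylor expansion at x, exact because the objective is quadratic; it yields
both the gradient and the minimizer. *)
Lemma quadraticD (R : realType) (n : nat) (A : 'M[R]_n) (b x v : 'cV[R]_n) :
  A^T = A ->
  quadratic A b (x + v) =
  quadratic A b x + dot v (A *m x - b) + 2^-1 * dot v (A *m v).
Proof.
move=> symA; rewrite /quadratic -!mulmxA -!/(dot _ _) mulmxDr !dot_bilin.
by rewrite [dot x (A *m v)]dot_sym // [dot v b]dotC; field.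
Qed.

Lemma gradient_quadratic (R : realType) (n : nat) (A : 'M[R]_n)
    (b x : 'cV[R]_n) : A^T = A -> gradient (quadratic A b) x = A *m x - b.
Proof.
move=> symA; apply/colP => i; rewrite mxE.
have -> : (A *m x - b) i 0 = dot (delta_mx i 0) (A *m x - b).
  by rewrite /dot trmx_delta -rowE [RHS]mxE.
set v := delta_mx i 0; set g := dot v _.
apply: cvg_lim => //.
have lim_g : (fun h : R => g + h * (2^-1 * dot v (A *m v))) @ 0^' --> g.
  apply: cvg_within_filter.
  rewrite -{2}[g](_ : g + 0 * (2^-1 * dot v (A *m v)) = g);
    last by rewrite mul0r addr0.
  by apply: cvgD; [exact: cvg_cst | apply: cvgM; [exact: cvg_id | exact: cvg_cst]].
apply: cvg_trans lim_g; apply: near_eq_cvg; near=> h.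
have h_neq0 : h != 0 by near: h; exact: nbhs_dnbhs_neq.
rewrite /= [h *: v + x]addrC quadraticD // -scalemxAr /g !dot_bilin.
by rewrite /GRing.scale /=; field.
Unshelve. all: by end_near. Qed.

Lemma quadratic_unique_minimizer (R : realType) (n : nat) (A : 'M[R]_n)
    (b : 'cV[R]_n) : symmetric_posdef A ->
  unique_minimizer (quadratic A b) (invmx A *m b).
Proof.
move=> spdA; have [symA posA] := spdA.
have expand y : quadratic A b y = quadratic A b (invmx A *m b)
    + 2^-1 * dot (y - invmx A *m b) (A *m (y - invmx A *m b)).
  rewrite -{1}[y](subrKC (invmx A *m b)) quadraticD // mulKVmx ?posdef_unitmx //.
  by rewrite subrr [X in _ + X + _]/dot mulmx0 mxE addr0.
split=> [y|z min_z].
  by rewrite (expand y) lerDl mulr_ge0 // posdef_possemidef.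
apply/eqP; rewrite -subr_eq0; apply: contraT => /posA.
rewrite -mulmxA -/(dot _ _) ltNge; have := min_z (invmx A *m b).
by rewrite (expand z) gerDl pmulr_rle0 // => ->.
Qed.

(** * Convergence of the iteration *)

Lemma cvg_col_of_dot (R : realType) (n : nat) (x : nat -> 'cV[R]_n)
    (y : 'cV[R]_n) :
  dot (x k - y) (x k - y) @[k --> \oo] --> (0 : R) -> x k @[k --> \oo] --> y.
Proof.
move=> dist0; apply/cvg_ballP => e e_gt0.
have := @cvgr_lt _ _ _ _ _ _ dist0 (e ^+ 2); rewrite exprn_gt0 // => /(_ _ isT).
apply: filterS => k lt_e; split=> // i j; rewrite (ord1 j) /ball /= distrC.
rewrite -(@ltr_pXn2r _ 2) ?nnegrE ?(ltW e_gt0) // (le_lt_trans _ lt_e) //.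
by have := sqr_coord_le (x k - y) i; rewrite !mxE real_normK ?num_real.
Qed.

(** This is <A^-1 (1 - A / l) w, w> for w = A u: a Lyapunov function for
multiplication by 1 - (2 / l) A, written without the inverse of A. *)
Definition energy (R : realType) (n : nat) (A : 'M[R]_n) (l : R)
    (u : 'cV[R]_n) : R :=
  dot u (A *m u) - l^-1 * dot (A *m u) (A *m u).

(** Cauchy-Schwarz for the form of A and the bound of that form by l give
|A u|^4 <= <u, A u> <A u, A A u> <= l <u, A u> |A u|^2. *)
Lemma energy_ge0 (R : realType) (n : nat) (A : 'M[R]_n) (l : R)
    (u : 'cV[R]_n) :
  symmetric_posdef A -> largest_eigenvalue A l -> 0 <= energy A l u.
Proof.
move=> spdA lA; have [symA _] := spdA.
have l_gt0 := eigenvalue_posdef_gt0 spdA lA.1.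
have psdA := posdef_possemidef spdA.
rewrite subr_ge0 ler_pdivrMl //.
have := psd_cauchy_schwarz symA psdA u (A *m u).
have := form_le_largest_eigenvalue symA lA (A *m u).
rewrite [dot u (A *m (A *m u))]dot_sym //.
have := psdA u; have := dot_ge0 (A *m u).
move: (dot u _) (dot (A *m u) (A *m (A *m u))) (dot (A *m u) _) => p r q.
move=> q0 p0 rq cs.
have [->|q_neq0] := eqVneq q 0; first by rewrite mulr_ge0 // ltW.
rewrite -(@ler_pM2r _ q) ?lt_neqAle ?q0 ?andbT 1?eq_sym //; nra.
Qed.

(** With M = 1 - A / l and B = 1 - (2 / l) A, one has 1 - B^2 = (4 / l) A M, so
the form of A^-1 M drops by (4 / l) M^2 under B: the inverse of A cancels, and
what remains is the squared norm of M w, where w = A u. *)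
Lemma energy_step (R : realType) (n : nat) (A : 'M[R]_n) (l : R)
    (u : 'cV[R]_n) : A^T = A -> l != 0 ->
  let e := A *m u - l^-1 *: (A *m (A *m u)) in
  energy A l u - energy A l (u - (2 / l) *: (A *m u)) = 4 / l * dot e e.
Proof.
move=> symA l_neq0 /=; rewrite /energy !mulmxBr -!scalemxAr !dot_bilin.
set w := A *m u.
rewrite [dot u (A *m w)]dot_sym // -/w [dot (A *m w) w]dotC.
by field.
Qed.

(** The vector [e k] is the iterate A u_k of the step 2 / l, filtered by 1 - A / l;
its squared norm is a difference of consecutive terms of the convergent sequence
of energies. *)
Lemma filtered_gd_cvg0 (R : realType) (n : nat) (A : 'M[R]_n) (l : R)
    (u : nat -> 'cV[R]_n) :
  symmetric_posdef A -> largest_eigenvalue A l ->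
  (forall k, u k.+1 = u k - (2 / l) *: (A *m u k)) ->
  let e k := A *m u k - l^-1 *: (A *m (A *m u k)) in
  dot (e k) (e k) @[k --> \oo] --> (0 : R).
Proof.
move=> spdA lA uS e; have l_gt0 := eigenvalue_posdef_gt0 spdA lA.1.
pose E k := energy A l (u k).
have E_step k : E k - E k.+1 = 4 / l * dot (e k) (e k).
  by rewrite /E uS energy_step ?gt_eqF // spdA.1.
have cvgE : cvgn E.
  apply: nonincreasing_is_cvgn.
    apply/nonincreasing_seqP => k; rewrite -subr_ge0 E_step.
    by rewrite mulr_ge0 ?dot_ge0 // divr_ge0 // ltW.
  by exists 0 => _ [k _ <-]; exact: energy_ge0.
have -> : (fun k => dot (e k) (e k)) = (fun k => l / 4 * (E k - E k.+1)).
  by apply/funext => k; rewrite E_step; field; rewrite gt_eqF.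
rewrite -(mulr0 (l / 4)) -(subrr (limn E)).
by apply: cvgM; [exact: cvg_cst | apply: cvgB; [|rewrite cvg_shiftS]].
Qed.

Theorem theorem8 (R : realType) (n : nat) (A : 'M[R]_n) (b : 'cV[R]_n)
    (lambda1 : R) (xm1 : 'cV[R]_n)
    (A_spd : symmetric_posdef A)
    (A_lambda1 : largest_eigenvalue A lambda1) :
  let f := quadratic A b in
  let x0 := xm1 - lambda1^-1 *: (A *m xm1 - b) in
  let x := gradient_descent f (2 / lambda1) x0 in
  let xstar := invmx A *m b in
  [/\ forall k : nat, x k.+1 = x k - (2 / lambda1) *: (A *m x k - b),
      unique_minimizer f xstar
    & x k @[k --> \oo] --> xstar].
Proof.
move=> f x0 x xstar.
have xS k : x k.+1 = x k - (2 / lambda1) *: (A *m x k - b).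
  by rewrite /x /gradient_descent iterS gradient_quadratic // A_spd.1.
split=> //; first exact: quadratic_unique_minimizer.
have unitA := posdef_unitmx A_spd.
(* The energy argument runs on preimages under A of the error of the unfiltered
   iteration started at xm1. *)
pose u k := iter k (fun v => v - (2 / lambda1) *: (A *m v))
  (invmx A *m (xm1 - xstar)).
have uS k : u k.+1 = u k - (2 / lambda1) *: (A *m u k) by rewrite /u iterS.
have residual y : A *m y - b = A *m (y - xstar).
  by rewrite mulmxBr mulKVmx.
have error k : x k - xstar = A *m u k - lambda1^-1 *: (A *m (A *m u k)).
  elim: k => [|k IHk].
    by rewrite /u /= mulKVmx // /x /= /x0 residual addrAC.
  rewrite xS residual addrAC IHk uS !mulmxBr -!scalemxAr.
  set a := A *m u k; set a2 := A *m a; set a3 := A *m a2.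
  by apply/colP => i; rewrite !mxE; ring.
apply: cvg_col_of_dot.
under eq_fun do rewrite error.
exact: filtered_gd_cvg0.
Qed.
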